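(* Let $\widetilde{\mathfrak g}$ be an affine Kac–Moody algebra over an algebraically closed field $K$ of characteristic $0$. Then every commutative $2$-cocycle $\varphi$ on $\widetilde{\mathfrak g}$ is trivial, i.e. $\varphi([\widetilde{\mathfrak g},\widetilde{\mathfrak g}],\widetilde{\mathfrak g})=0$.
   Context: A commutative $2$-cocycle on a Lie algebra $L$ over $K$ is a symmetric bilinear form $\varphi:L\times L\to K$ such that $\varphi([x,y],z)+\varphi([z,x],y)+\varphi([y,z],x)=0$ for all $x,y,z\in L$; it is called trivial if it vanishes whenever one argument lies in $[L,L]$. Affine Kac–Moody algebras are taken in the standard realization: for a simple finite-dimensional Lie algebra $\mathfrak g=\bigoplus_{j\in\mathbb Z_n}\mathfrak g_j$ with a $\mathbb Z_n$-grading (coming from a diagram automorphism of order $n$; $n=1$ in the non-twisted case), let $L(\mathfrak g,n)=\bigoplus_{i\in\mathbb Z}\mathfrak g_{i\bmod n}\otimes t^i\subseteq\mathfrak g\otimes K[t,t^{-1}]$, let $\widehat L(\mathfrak g,n)$ be its standard non-split one-dimensional central extension, and the affine Kac–Moody algebra is $\widehat L(\mathfrak g,n)\oplus Kt\frac{d}{dt}$, where $t\frac{d}{dt}$ acts as a derivation of the Laurent polynomials. *)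

(* Defs.v *)
From HB Require Import structures.
From mathcomp Require Import all_boot all_order all_algebra all_fingroup.
From mathcomp Require Import boolp classical_sets functions cardinality fsbigop.

Set Implicit Arguments.
Unset Strict Implicit.
Unset Printing Implicit Defensive.

Import Order.TTheory GRing.Theory Num.Theory.
Local Open Scope ring_scope.
Local Open Scope classical_set_scope.

Section LieGeneric.
Variables (K : fieldType) (V : lmodType K).

Definition lie_algebra_on (S : set V) (br : V -> V -> V) : Prop :=
  S 0 /\
  (forall a x y, S x -> S y -> S (a *: x + y)) /\
  (forall x y, S x -> S y -> S (br x y)) /\
  (forall a x y z, S x -> S y -> S z ->
      br (a *: x + y) z = a *: br x z + br y z) /\
  (forall x, S x -> br x x = 0) /\
  (forall x y z, S x -> S y -> S z ->
      br x (br y z) + br y (br z x) + br z (br x y) = 0).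

Definition comm_cocycle_on (S : set V) (br : V -> V -> V)
    (phi : V -> V -> K) : Prop :=
  [/\ (forall x y, S x -> S y -> phi x y = phi y x),
      (forall a x y z, S x -> S y -> S z ->
          phi (a *: x + y) z = a * phi x z + phi y z)
    & (forall x y z, S x -> S y -> S z ->
          phi (br x y) z + phi (br z x) y + phi (br y z) x = 0)].

(* The derived algebra [L, L]: the linear span of all brackets of elements
   of S (finite sums of brackets, scalars absorbed into the first entry). *)
Definition derived_on (S : set V) (br : V -> V -> V) (x : V) : Prop :=
  exists s : seq (V * V),
    (forall p, p \in s -> S p.1 /\ S p.2) /\
    x = \sum_(p <- s) br p.1 p.2.

Definition trivial_cocycle_on (S : set V) (br : V -> V -> V)
    (phi : V -> V -> K) : Prop :=
  forall x y, derived_on S br x -> S y -> phi x y = 0 /\ phi y x = 0.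

End LieGeneric.

Section FinDimLie.
Variables (K : fieldType) (g : vectType K) (br : g -> g -> g).

Definition simple_lie : Prop :=
  (exists x y, br x y != 0) /\
  forall U : {vspace g}, (forall x y, x \in U -> br y x \in U) ->
    U = 0%VS \/ U = fullv.

Definition chevalley_system (I : finType) (A : I -> I -> int)
    (e f h : I -> g) : Prop :=
  (forall i, A i i = 2%:Z) /\
  (forall i j, i != j -> A i j <= 0) /\
  (forall i j, (A i j == 0) = (A j i == 0)) /\
  free [seq h i | i <- enum I] /\
  (forall i j, br (h i) (h j) = 0) /\
  (forall i j, br (e i) (f j) = if i == j then h i else 0) /\
  (forall i j, br (h i) (e j) = (A i j)%:~R *: e j) /\
  (forall i j, br (h i) (f j) = - ((A i j)%:~R *: f j)) /\
  (forall U : {vspace g}, (forall i, e i \in U /\ f i \in U) ->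
      (forall x y, x \in U -> y \in U -> br x y \in U) -> U = fullv).

Definition lie_automorphism (s : g -> g) : Prop :=
  [/\ (forall a x y, s (a *: x + y) = a *: s x + s y),
      bijective s
    & (forall x y, s (br x y) = br (s x) (s y))].

Definition diagram_automorphism (s : g -> g) : Prop :=
  lie_automorphism s /\
  exists (I : finType) (A : I -> I -> int) (e f h : I -> g) (pi : {perm I}),
    [/\ chevalley_system A e f h,
        (forall i j, A (pi i) (pi j) = A i j)
      & (forall i, s (e i) = e (pi i) /\ s (f i) = f (pi i))].

Definition has_order (s : g -> g) (n : nat) : Prop :=
  [/\ (0 < n)%N, (forall x, iter n s x = x)
    & (forall m, (0 < m < n)%N -> ~ (forall x, iter m s x = x))].

(* Killing form  (x|y) = tr(ad x ad y), the trace being computed in the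
   basis vbasis fullv of g. *)
Definition killing (x y : g) : K :=
  \sum_(i < \dim {:g})
     coord (vbasis fullv) i (br x (br y (tnth (vbasis fullv) i))).

End FinDimLie.

(* The affine Kac--Moody algebra  L^(g, n) (+) K t d/dt.                     *)
(* Elements of g (x) K[t, t^-1] are finitely supported f : int -> g,         *)
(* f = sum_i f(i) (x) t^i.  An element of the ambient space                  *)
(* ((int -> g) * K) * K is  ((f, a), b) = f + a c + b d  with c the central  *)
(* element and d = t d/dt.                                                   *)
Notation aff_space K g := ((int -> g) * K^o * K^o)%type.

Section Affine.
Variables (K : fieldType) (g : vectType K) (br : g -> g -> g).


Definition loop_br (f h : int -> g) : int -> g :=
  fun k => \sum_(i \in [set: int]) br (f i) (h (k - i)).

Definition tder (f : int -> g) : int -> g := fun k => k%:~R *: f k.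

(* the standard cocycle  (x t^i, y t^j) |-> i delta_{i+j,0} (x|y) *)
Definition loop_cocycle (f h : int -> g) : K :=
  \sum_(i \in [set: int]) i%:~R * killing br (f i) (h (- i)).

Definition aff_br (x y : aff_space K g) : aff_space K g :=
  (loop_br x.1.1 y.1.1 + x.2 *: tder y.1.1 - y.2 *: tder x.1.1,
   loop_cocycle x.1.1 y.1.1, 0).

(* The affine Kac--Moody algebra for the Z_n-grading g_j = {x | s x = w^j x}
   (w a primitive n-th root of unity): finitely supported f with
   f(i) in g_(i mod n), plus K c + K d. *)
Definition affine_km (s : g -> g) (w : K) : set (aff_space K g) :=
  [set x | finite_set [set i | x.1.1 i != 0] /\
           forall i : int, s (x.1.1 i) = (w ^ i) *: x.1.1 i].

End Affine.

(* Main.v *)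
(* Write [X = x t^i], [Y = y t^j], [Z = z t^k], and put [psi = phi (., d)].
   As [X] and [Y] are eigenvectors of [ad d], the cocycle identity on
   [(X, Y, d)] reads [psi [X, Y] = (j - i) phi (X, Y)]:
   off the diagonal [phi] is determined by [psi].  Substituting this in the
   identity on [(X, Y, Z)] gives, with [m = i + j + k] and up to central terms,
     [psi [[X, Y], Z] / (2k - m) + psi [[Z, X], Y] / (2j - m)
        + psi [[Y, Z], X] / (2i - m) = 0].
   The numerators depend only on [m] and on the classes of [i, j, k] modulo [n]
   and sum to 0, so varying the exponents inside these classes kills all of
   them.  As [g = [[g, g], g]], [psi] vanishes, hence so does [phi (X, Y)] for
   [i <> j]; the diagonal case follows from the identity with [k = i + j].
   The central terms disappear in the same way, by invariance of the Killing
   form. *)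
Require Import Defs.
From HB Require Import structures.
From mathcomp Require Import all_boot all_order all_algebra all_fingroup.
From mathcomp Require Import boolp classical_sets functions cardinality fsbigop.
From mathcomp Require Import finmap zify ring.

Set Implicit Arguments.
Unset Strict Implicit.
Unset Printing Implicit Defensive.

Import Order.TTheory GRing.Theory Num.Theory passmx.
Local Open Scope ring_scope.

Lemma eq_of_subr_eq (V : zmodType) (a b c d : V) :
  c = d -> a - b = c - d -> a = b.
Proof. by move=> -> ab; apply/eqP; rewrite -subr_eq0 ab subrr. Qed.

Lemma sum_expr_unity_root (R : idomainType) (n : nat) (z : R) :
  z ^+ n = 1 -> \sum_(l < n) z ^+ l = if z == 1 then n%:R else 0.
Proof.
move=> zn; case: eqVneq => [->|z1].
  by under eq_bigr do rewrite expr1n; rewrite sumr_const card_ord.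
by apply: (mulfI (x := z - 1)); rewrite ?subr_eq0 // -subrX1 zn subrr mulr0.
Qed.

Lemma separating_shift (n : nat) (i j k : int) : (0 < n)%N ->
  exists A : int, forall T : nat,
    let i' := i + n%:Z * (A + T%:Z) in
    let j' := j + n%:Z * - (A + A + T%:Z) in
    let k' := k + n%:Z * A in
    [/\ k' - (i' + j') != 0, i' - (j' + k') != 0, j' - (k' + i') != 0
      & k' != 0].
Proof.
move=> n_gt0; pose A : int := `|i| + `|j| + `|k| + 1; exists A => T /=.
have nA : A <= n%:Z * A by rewrite ler_peMl // /A; lia.
have nT : 0 <= n%:Z * T%:Z by lia.
by rewrite !(mulrN, mulrDr); split; rewrite /A in nA *; lia.
Qed.

Section FieldFacts.
Variable K : fieldType.

Lemma intr_eq0_pchar0 (charK0 : [pchar K] =i pred0) (z : int) :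
  (z%:~R == 0 :> K) = (z == 0).
Proof.
have nat0 := (pcharf0P K).1 charK0.
by case: z => n; rewrite ?NegzE ?mulrNz ?oppr_eq0 /= -?pmulrn nat0.
Qed.

Lemma reciprocal_sum_eq0 (p q e r u v t c : K) :
  (2 : K) != 0 -> e != 0 -> r != 0 -> p + q != 0 -> u + v + t = 0 ->
  (forall T : nat, [/\ p + T%:R * e != 0, q - T%:R * e != 0 &
     u / r + v / (q - T%:R * e) + t / (p + T%:R * e) + c = 0]) ->
  u = 0 /\ c = 0.
Proof.
move=> two_neq0 e_neq0 r_neq0 pq_neq0 uvt0 sum0.
pose D := c + u / r.
pose G T : K := v * (p + T%:R * e) + t * (q - T%:R * e)
          + D * (p + T%:R * e) * (q - T%:R * e).
have G0 T : G T = 0.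
  have [pT_neq0 qT_neq0 sumT0] := sum0 T.
  rewrite -(mul0r ((p + T%:R * e) * (q - T%:R * e))) -sumT0 /G /D.
  by field; rewrite r_neq0 pT_neq0 qT_neq0.
have D0 : D = 0.
  apply: (mulIf (mulf_neq0 two_neq0 (mulf_neq0 e_neq0 e_neq0))).
  have -> : D * (2 * (e * e)) = 2 * G 1%N - G 0%N - G 2%N by rewrite /G; ring.
  by rewrite !G0 mulr0 !subr0 mul0r.
have vt : v = t.
  apply/eqP; rewrite -subr_eq0; apply/eqP/(mulIf e_neq0).
  have -> : (v - t) * e = G 1%N - G 0%N by rewrite /G D0; ring.
  by rewrite !G0 subr0 mul0r.
have t0 : t = 0.
  apply: (mulIf pq_neq0).
  have -> : t * (p + q) = G 0%N by rewrite /G D0 vt; ring.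
  by rewrite G0 mul0r.
have u0 : u = 0 by rewrite -uvt0 vt t0 !addr0.
by split=> //; rewrite -D0 /D u0 mul0r addr0.
Qed.

Lemma weighted_reciprocal_sum_eq0 (n : nat) (i j k : int) (u v t c : K) :
  [pchar K] =i pred0 -> (0 < n)%N -> u + v + t = 0 ->
  (forall a b e : int, a + b + e = 0 ->
     let i' := i + n%:Z * a in let j' := j + n%:Z * b in
     let k' := k + n%:Z * e in
     (k' - (i' + j'))%:~R != 0 :> K -> (j' - (k' + i'))%:~R != 0 :> K ->
     (i' - (j' + k'))%:~R != 0 :> K ->
     u / (k' - (i' + j'))%:~R + v / (j' - (k' + i'))%:~R
     + t / (i' - (j' + k'))%:~R + c = 0) ->
  u = 0 /\ c = 0.
Proof.
move=> charK0 n_gt0 uvt0 sum0.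
have natr_neq0 l : (0 < l)%N -> l%:R != 0 :> K.
  by rewrite ((pcharf0P K).1 charK0) lt0n.
have [A sep] := separating_shift i j k n_gt0.
pose I (T : nat) : int := i + n%:Z * (A + T%:Z).
pose J (T : nat) : int := j + n%:Z * - (A + A + T%:Z).
pose k' : int := k + n%:Z * A.
have kE T : k' - (I T + J T) = k' - (I 0%N + J 0%N) by rewrite /I /J; ring.
pose p : K := (I 0%N - (J 0%N + k'))%:~R.
pose q : K := (J 0%N - (k' + I 0%N))%:~R.
have IE T : (I T - (J T + k'))%:~R = p + T%:R * (2 * n%:R) :> K.
  by rewrite /p /I /J; ring.
have JE T : (J T - (k' + I T))%:~R = q - T%:R * (2 * n%:R) :> K.
  by rewrite /q /I /J; ring.
have sepK T : [/\ (k' - (I T + J T))%:~R != 0 :> K,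
    (I T - (J T + k'))%:~R != 0 :> K, (J T - (k' + I T))%:~R != 0 :> K
    & k'%:~R != 0 :> K].
  by have [? ? ? ?] := sep T; rewrite !intr_eq0_pchar0.
have [k_neq0 _ _ k'_neq0] := sepK 0%N.
have pq_neq0 : p + q != 0.
  have -> : p + q = - (2 * k'%:~R) by rewrite /p /q; ring.
  by rewrite oppr_eq0 mulf_neq0 ?natr_neq0.
apply: (reciprocal_sum_eq0 _ _ k_neq0 pq_neq0 uvt0 (e := 2 * n%:R)) => [||T].
- exact: natr_neq0.
- by rewrite mulf_neq0 ?natr_neq0.
have [kT_neq0 IT_neq0 JT_neq0 _] := sepK T.
by rewrite -IE -JE -(kE T); split=> //; apply: sum0 => //; ring.
Qed.

End FieldFacts.

(* The transposition (23) is conjugate both to (12), which fixes [T], and to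
   (13), which changes its sign. *)
Lemma triadditive_sym_alt_eq0 (U V : zmodType) (T : U -> U -> U -> V) :
  (forall v : V, v + v = 0 -> v = 0) ->
  (forall x x' y z, T (x + x') y z = T x y z + T x' y z) ->
  (forall x y z z', T x y (z + z') = T x y z + T x y z') ->
  (forall x y z, T x y z = T y x z) -> (forall x y, T x y x = 0) ->
  forall x y z, T x y z = 0.
Proof.
move=> no2torsion TDl TDr Tsym Talt.
have Tskew x y z : T x y z = - T z y x.
  apply/eqP; rewrite -addr_eq0; apply/eqP.
  by have := Talt (x + z) y; rewrite TDl !TDr !Talt add0r addr0.
move=> x y z; apply: no2torsion; apply/eqP; rewrite addr_eq0; apply/eqP.
by rewrite {1}Tsym Tskew (Tsym z) Tskew opprK Tsym Tskew.
Qed.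

(* [F x y z] stands for a coordinate of [[x, [y, z]]], where the bracket is
   linear in its first argument only. *)
Section JacobiForm.
Variables (K : fieldType) (V : lmodType K) (F : V -> V -> V -> K).
Hypothesis two_neq0 : (2 : K) != 0.
Hypothesis F_linear :
  forall a x x' y z, F (a *: x + x') y z = a * F x y z + F x' y z.
Hypothesis F0m : forall x z, F x 0 z = 0.
Hypothesis F_shift : forall t x y z, F x (y + t *: z) z = F x y z.
Hypothesis F_jacobi : forall x y z, F x y z + F y z x + F z x y = 0.

Let FDl x x' y z : F (x + x') y z = F x y z + F x' y z.
Proof. by rewrite -[x]scale1r F_linear mul1r scale1r. Qed.

Let F0l y z : F 0 y z = 0.
Proof. by apply: (addrI (F 0 y z)); rewrite -FDl !addr0. Qed.

Let no2torsion (v : K) : v + v = 0 -> v = 0.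
Proof.
rewrite -mulr2n -mulr_natl => /eqP.
by rewrite mulf_eq0 (negPf two_neq0) => /eqP.
Qed.

Lemma jacobi_form0r x y : F x y 0 = 0.
Proof. by have := F_jacobi x y 0; rewrite F0m F0l !addr0. Qed.

Lemma jacobi_form_affine t x y z : F y z (x + t *: y) = F y z x + t * F y z y.
Proof.
have F_alt u v : F u v v = 0.
  by rewrite -[v in F _ v _]scale1r -[1 *: v]add0r F_shift F0m.
have yyz := F_jacobi y y z; rewrite F_alt addr0 in yyz.
have := F_jacobi (t *: y + x) y z.
rewrite F_linear [X in F z X y]addrC F_shift => xyz.
apply: (eq_of_subr_eq (etrans xyz (esym (F_jacobi x y z)))).
have -> : F y z y = - F y y z by apply: (eq_of_subr_eq yyz); ring.
by rewrite [t *: y + x]addrC; ring.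
Qed.

(* Expanding [Q (u + v + t)] in two ways makes the defect of additivity [D] of
   [H] symmetric in its three arguments. *)
Lemma jacobi_formDr x y z z' : F x y (z + z') = F x y z + F x y z'.
Proof.
pose H u v := F v y u; pose Q u := H u u.
have HDr u v v' : H u (v + v') = H u v + H u v' by exact: FDl.
have Hdiag u v : H (u + v) v = H u v + Q v.
  by have := jacobi_form_affine 1 u v y; rewrite scale1r mul1r.
have QD u v : Q (u + v) = Q u + Q v + H u v + H v u.
  by rewrite {1}/Q HDr Hdiag [u + v]addrC Hdiag; ring.
pose D u v t := H (u + v) t - H u t - H v t.
have Dsym u v t : D u v t = D v u t by rewrite /D (addrC u); ring.
have Drot u v t : D u v t = D v t u.
  have := QD (u + v) t; rewrite -addrA (QD u) !QD !HDr => Quvt.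
  by apply: (eq_of_subr_eq (esym Quvt)); rewrite /D; ring.
have DDr u v t t' : D u v (t + t') = D u v t + D u v t'.
  by rewrite /D !HDr; ring.
have DDl u u' v t : D (u + u') v t = D u v t + D u' v t.
  by rewrite Drot DDr -(Drot u) -(Drot u').
have Dalt u v : D u v u = 0 by rewrite Dsym /D Hdiag /Q; ring.
have := triadditive_sym_alt_eq0 no2torsion DDl DDr Dsym Dalt z z' x.
by move=> D0; apply: (eq_of_subr_eq D0); rewrite /D /H; ring.
Qed.

Lemma jacobi_form_skew x y z : F x y z = - F x z y.
Proof.
have F_alt : F x (y + z) (y + z) = 0.
  by rewrite -[X in F _ X _]add0r -[X in F _ (_ + X) _]scale1r F_shift F0m.
have shift1 u v : F x (u + v) v = F x u v.
  by rewrite -[v in u + v]scale1r F_shift.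
apply/eqP; rewrite -addr_eq0 -F_alt jacobi_formDr shift1.
by rewrite [y + z]addrC shift1 addrC.
Qed.

Lemma jacobi_formZr a x y z : F x y (a *: z) = a * F x y z.
Proof.
pose T u v t := F u v (a *: t) - a * F u v t.
have TDl u u' v t : T (u + u') v t = T u v t + T u' v t.
  by rewrite /T !FDl; ring.
have TDr u v t t' : T u v (t + t') = T u v t + T u v t'.
  by rewrite /T scalerDr !jacobi_formDr; ring.
have Talt u v : T u v u = 0.
  have := jacobi_form_affine a 0 u v.
  by rewrite !add0r jacobi_form0r add0r /T => ->; ring.
have Tsym u v t : T u v t = T v u t.
  have FZl b p q r : F (b *: p) q r = b * F p q r.
    by rewrite -[b *: p]addr0 F_linear F0l addr0.
  have auvt := F_jacobi u v (a *: t).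
  rewrite FZl [F v _ u]jacobi_form_skew in auvt.
  have uvt := F_jacobi u v t; rewrite [F v t u]jacobi_form_skew in uvt.
  apply: (eq_of_subr_eq (congr2 (fun p q => p - a * q) auvt uvt)).
  by rewrite /T; ring.
apply/eqP; rewrite -subr_eq0; apply/eqP.
exact: (triadditive_sym_alt_eq0 no2torsion TDl TDr Tsym Talt).
Qed.

End JacobiForm.

Section VectorSpaceFacts.
Variables (K : fieldType) (g : vectType K).

Lemma coord_vbasis_inj (x y : g) :
  (forall i, coord (vbasis fullv) i x = coord (vbasis fullv) i y) -> x = y.
Proof.
move=> exy; rewrite (coord_vbasis (memvf x)) (coord_vbasis (memvf y)).
by apply: eq_bigr => i _; rewrite exy.
Qed.

Lemma vspace_of_linear_pred (P : g -> Prop) :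
  P 0 -> (forall a x y, P x -> P y -> P (a *: x + y)) ->
  exists U : {vspace g}, forall x, x \in U <-> P x.
Proof.
move=> P0 Plin.
pose sub (U : {vspace g}) := forall x, x \in U -> P x.
have sub_dim : exists k, `[< exists2 U, sub U & \dim U = k >].
  exists 0%N; apply/asboolP; exists 0%VS; last exact: dimv0.
  by move=> x; rewrite memv0 => /eqP ->.
have dim_bound k : `[< exists2 U, sub U & \dim U = k >] -> (k <= \dim {:g})%N.
  by move=> /asboolP[U _ <-]; exact/dimvS/subvf.
have [k /asboolP[U subU dimU] kmax] := ex_maxnP sub_dim dim_bound.
exists U => x; split; first exact: subU.
move=> Px; have subUx : sub (U + <[x]>)%VS.
  move=> _ /memv_addP[u uU [_ /vlineP[a ->] ->]].
  by rewrite addrC; apply: Plin => //; exact: subU.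
have dim_le : (\dim (U + <[x]>) <= \dim U)%N.
  by rewrite dimU; apply: kmax; apply/asboolP; exists (U + <[x]>)%VS.
have -> : U = (U + <[x]>)%VS by apply/eqP; rewrite eqEdim addvSl dim_le.
exact/(subvP (addvSr _ _))/memv_line.
Qed.

End VectorSpaceFacts.

Definition perfect_lie (K : fieldType) (g : lmodType K) (br : g -> g -> g) :
  Prop :=
  forall x, derived_on setT br x.

(* [lie_algebra_on] only asks for linearity of the bracket on the left;
   simplicity supplies skew-symmetry, hence linearity on the right. *)
Section SimpleLie.
Variables (K : fieldType) (g : vectType K) (br : g -> g -> g).
Hypothesis (two_neq0 : (2 : K) != 0) (three_neq0 : (3 : K) != 0).
Hypotheses (lie_g : lie_algebra_on setT br) (simple_g : simple_lie br).

Let br_linearl a x y z : br (a *: x + y) z = a *: br x z + br y z.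
Proof. by case: lie_g => _ [_ [_ [lin _]]]; exact: lin. Qed.

Let br_alt x : br x x = 0.
Proof. by case: lie_g => _ [_ [_ [_ [alt _]]]]; exact: alt. Qed.

Lemma lie_jacobi x y z : br x (br y z) + br y (br z x) + br z (br x y) = 0.
Proof. by case: lie_g => _ [_ [_ [_ [_ jac]]]]; exact: jac. Qed.

Let br_addl x y z : br (x + y) z = br x z + br y z.
Proof. by rewrite -[x]scale1r br_linearl !scale1r. Qed.

Let br0l z : br 0 z = 0.
Proof. by apply: (addrI (br 0 z)); rewrite -br_addl !addr0. Qed.

Let br_scalel a x z : br (a *: x) z = a *: br x z.
Proof. by rewrite -[a *: x]addr0 br_linearl br0l addr0. Qed.

Let br0r x : br x 0 = 0.
Proof.
have jac := lie_jacobi x x x; rewrite br_alt in jac.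
have : (3 : K) *: br x 0 = 0 by rewrite scaler_nat !mulrS addr0 addrA.
by move/eqP; rewrite scaler_eq0 (negPf three_neq0) => /eqP.
Qed.

Let F i x y z : K := coord (vbasis fullv) i (br x (br y z)).

Let F_linear i a x x' y z : F i (a *: x + x') y z = a * F i x y z + F i x' y z.
Proof. by rewrite /F br_linearl linearP. Qed.

Let F0m i x z : F i x 0 z = 0.
Proof. by rewrite /F br0l br0r linear0. Qed.

Let F_shift i t x y z : F i x (y + t *: z) z = F i x y z.
Proof. by rewrite /F addrC br_linearl br_alt scaler0 add0r. Qed.

Let F_jacobi i x y z : F i x y z + F i y z x + F i z x y = 0.
Proof. by rewrite /F -!linearD lie_jacobi linear0. Qed.

Lemma br_br_addr x y z z' :
  br x (br y (z + z')) = br x (br y z) + br x (br y z').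
Proof.
apply: coord_vbasis_inj => i; rewrite linearD.
exact: (jacobi_formDr two_neq0 (F_linear i)).
Qed.

Lemma br_br_scaler a x y z : br x (br y (a *: z)) = a *: br x (br y z).
Proof.
apply: coord_vbasis_inj => i; rewrite linearZ.
exact: (jacobi_formZr two_neq0 (F_linear i)).
Qed.

Lemma br_br_skew x y z : br x (br y z) = - br x (br z y).
Proof.
apply: coord_vbasis_inj => i; rewrite linearN.
exact: (jacobi_form_skew two_neq0 (F_linear i)).
Qed.

(* The elements [v] with [[y, [z, v]] = 0] for all [y] and [z] form an ideal
   that contains every [[x, y] + [y, x]]. *)
Lemma simple_lie_skew x y : br x y = - br y x.
Proof.
have [[y0 [z0 br_neq0]] ideal] := simple_g.
pose P v := forall y z, br y (br z v) = 0.
have [||U memU] := @vspace_of_linear_pred K g P.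
- by move=> u v; rewrite !br0r.
- move=> a u v Pu Pv b c.
  by rewrite br_br_addr br_br_scaler Pu Pv scaler0 addr0.
have P_sym u v : P (br u v + br v u).
  move=> a b; have br_brN w : br a (- br b w) = - br a (br b w).
    rewrite -!scaleN1r -br_scalel br_br_skew [br a (br b w)]br_br_skew.
    by rewrite br_br_scaler scalerN.
  by rewrite br_br_addr [br b (br u v)]br_br_skew br_brN addNr.
have [|U0|UT] := ideal U.
- by move=> u v /memU Pu; apply/memU => a b; rewrite Pu br0r.
- by have /memU := P_sym x y; rewrite U0 memv0 addr_eq0 => /eqP.
have br_br0 a b c : br a (br b c) = 0.
  by have := memvf c; rewrite -UT => /memU; apply.
have [|/eqP|lineT] := ideal <[br y0 z0]>%VS.
- by move=> _ v /vlineP[a ->]; rewrite -br_scalel br_br0 mem0v.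
- by rewrite -subv0 -memvE memv0 (negPf br_neq0).
have : z0 \in <[br y0 z0]>%VS by rewrite lineT memvf.
by move=> /vlineP[a za]; move: br_neq0; rewrite {1}za -br_scalel br_br0 eqxx.
Qed.

Lemma simple_lie_bilinear : bilinear_for *:%R *:%R br.
Proof.
split=> z a x y; first exact: br_linearl.
by rewrite [LHS]simple_lie_skew br_linearl opprD -scalerN -!simple_lie_skew.
Qed.

Lemma simple_lie_perfect : perfect_lie br.
Proof.
move=> x.
have [||U memU] := @vspace_of_linear_pred K g (derived_on setT br).
- by exists [::]; rewrite big_nil.
- move=> a _ _ [r [_ ->]] [r' [_ ->]].
  exists ([seq (a *: p.1, p.2) | p <- r] ++ r'); split=> //.
  rewrite big_cat big_map /= scaler_sumr; congr (_ + _).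
  by apply: eq_bigr => p _; rewrite br_scalel.
have br_in_U y z : br y z \in U.
  by apply/memU; exists [:: (y, z)]; rewrite big_seq1.
have [|U0|UT] := simple_g.2 U; first by move=> u v _.
- by have [y [z /negP[]]] := simple_g.1; rewrite -memv0 -U0.
- by apply/memU; rewrite UT memvf.
Qed.

End SimpleLie.

Lemma mxtrace_mxof (K : fieldType) (V : vectType K) (e : (\dim {:V}).-tuple V)
    (f : 'End(V)) :
  \tr (mxof e e f) = \sum_i coord e i (f (tnth e i)).
Proof.
apply: eq_bigr => i _.
by rewrite !mxE /= vecof_delta (tnth_nth 0).
Qed.

Section Killing.
Variables (K : fieldType) (g : vectType K) (br : {bilinear g -> g -> g}).
Hypothesis br_skew : forall x y, br x y = - br y x.
Hypothesis br_jacobi :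
  forall x y z, br x (br y z) + br y (br z x) + br z (br x y) = 0.

Lemma br_derivation x y z : br (br x y) z = br x (br y z) - br y (br x z).
Proof.
have := br_jacobi x y z; rewrite [br z x]br_skew [br z _]br_skew linearNr.
by move/eqP; rewrite subr_eq0 => /eqP.
Qed.

Lemma br_br_cyclic x y z : br (br x y) z + br (br z x) y + br (br y z) x = 0.
Proof.
rewrite (br_skew (br x y)) (br_skew (br z x)) (br_skew (br y z)) -!opprD.
by rewrite addrC [X in - (_ + X)]addrC addrA br_jacobi oppr0.
Qed.

Definition ad_mx (x : g) : 'M[K]_(\dim {:g}) :=
  mxof (vbasis fullv) (vbasis fullv) (linfun (br x)).

Lemma killing_mxtrace x y : killing br x y = \tr (ad_mx y *m ad_mx x).
Proof.
rewrite /ad_mx -mxof_comp ?vbasisP // mxtrace_mxof.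
by apply: eq_bigr => i _; rewrite comp_lfunE !lfunE.
Qed.

Lemma ad_mx_br x y : ad_mx (br x y) = ad_mx y *m ad_mx x - ad_mx x *m ad_mx y.
Proof.
rewrite /ad_mx -!mxof_comp ?vbasisP // -linearB; congr mxof.
apply/lfunP => z.
by rewrite !lfunE /= !lfunE /= !comp_lfunE !lfunE /= br_derivation.
Qed.

Lemma killingC x y : killing br x y = killing br y x.
Proof. by rewrite !killing_mxtrace mxtrace_mulC. Qed.

Lemma killing_invariant x y z : killing br (br x y) z = killing br x (br y z).
Proof.
rewrite !killing_mxtrace !ad_mx_br mulmxBr mulmxBl !(linearB mxtrace) /=.
rewrite !mulmxA.
by congr (_ - _); rewrite mxtrace_mulC mulmxA.
Qed.

Lemma killingDl x y z : killing br (x + y) z = killing br x z + killing br y z.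
Proof.
by rewrite /killing -big_split; apply: eq_bigr => i _; rewrite linearDl linearD.
Qed.

Lemma killing0l x : killing br 0 x = 0.
Proof. by rewrite /killing big1 // => i _; rewrite linear0l linear0. Qed.

Lemma killing0r x : killing br x 0 = 0.
Proof. by rewrite killingC killing0l. Qed.

End Killing.

Section Homogeneous.
Variables (K : fieldType) (V : lmodType K) (s : {linear V -> V}).
Variables (n : nat) (w : K).
Hypothesis (prim_w : n.-primitive_root w).

Definition homogeneous (i : int) (x : V) : Prop := s x = w ^ i *: x.

Lemma prim_root_neq0 : w != 0.
Proof. by rewrite (prim_root_eq0 prim_w) -lt0n (prim_order_gt0 prim_w). Qed.

Lemma prim_root_exprz (T : int) : w ^ (n%:Z * T) = 1.
Proof. by rewrite -exprz_exp -exprnP (prim_expr_order prim_w) exp1rz. Qed.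

Lemma homogeneous0 i : homogeneous i 0.
Proof. by rewrite /homogeneous linear0 scaler0. Qed.

Lemma homogeneousP i a x y :
  homogeneous i x -> homogeneous i y -> homogeneous i (a *: x + y).
Proof.
by rewrite /homogeneous linearP => -> ->; rewrite scalerDr !scalerA mulrC.
Qed.

Lemma homogeneousD i x y :
  homogeneous i x -> homogeneous i y -> homogeneous i (x + y).
Proof. by move=> hx hy; rewrite -[x]scale1r; exact: homogeneousP. Qed.

Lemma homogeneousZ i a x : homogeneous i x -> homogeneous i (a *: x).
Proof.
by move=> hx; rewrite -[_ *: _]addr0; exact: homogeneousP (homogeneous0 i).
Qed.

Lemma homogeneous_shift i (T : int) x :
  homogeneous i x -> homogeneous (i + n%:Z * T) x.
Proof.
rewrite /homogeneous => ->.
by rewrite expfzDr ?prim_root_neq0 // prim_root_exprz mulr1.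
Qed.

Lemma iter_homogeneous l i x :
  homogeneous i x -> iter l s x = (w ^ i) ^+ l *: x.
Proof.
move=> hx; elim: l => [|l /= ->]; first by rewrite scale1r.
by rewrite linearZ /= hx scalerA exprSr.
Qed.

Hypothesis s_order : forall x, iter n s x = x.

Lemma iter_linear l : linear (iter l s).
Proof. by move=> a x y; elim: l => //= l ->; rewrite linearP. Qed.

(* Averages over the powers of [s], twisted by a character of Z/n. *)
Definition homog_proj (m : int) (x : V) : V :=
  n%:R^-1 *: \sum_(l < n) (w ^ (- m)) ^+ l *: iter l s x.

Lemma homog_proj_linear m : linear (homog_proj m).
Proof.
move=> a x y; rewrite /homog_proj scalerA [a * _]mulrC -scalerA -scalerDr.
congr (_ *: _).
rewrite scaler_sumr -big_split; apply: eq_bigr => l _.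
by rewrite iter_linear scalerDr !scalerA [a * _]mulrC.
Qed.

HB.instance Definition _ m :=
  GRing.isLinear.Build K V V _ (homog_proj m) (homog_proj_linear m).

Lemma homog_proj_id m x : homogeneous m x -> homog_proj m x = x.
Proof.
move=> hx; rewrite /homog_proj (eq_bigr (fun=> x)).
  rewrite sumr_const card_ord -scaler_nat scalerA mulVf ?scale1r //.
  exact: prim_root_natf_neq0 prim_w.
move=> l _; rewrite (iter_homogeneous _ hx) scalerA -exprMn.
by rewrite -expfzDr ?prim_root_neq0 // addNr expr0z expr1n scale1r.
Qed.

Lemma homogeneous_homog_proj m x : homogeneous m (homog_proj m x).
Proof.
pose F l := (w ^ (- m)) ^+ l *: iter l s x.
have Fn : F n = F 0%N.
  by rewrite /F s_order exprnP exprz_exp mulrC prim_root_exprz expr0.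
have F_rot : \sum_(l < n) F l.+1 = \sum_(l < n) F l.
  apply: (addrI (F 0%N)); rewrite -(big_ord_recl n (fun l => F l)).
  by rewrite big_ord_recr addrC /= Fn.
rewrite /homogeneous /homog_proj linearZ /= scalerA mulrC -scalerA.
congr (_ *: _).
rewrite -[in RHS]F_rot linear_sum scaler_sumr; apply: eq_bigr => l _.
rewrite linearZ /= /F scalerA exprS mulrA -expfzDr ?prim_root_neq0 //.
by rewrite subrr mul1r.
Qed.

Lemma sum_homog_proj x : \sum_(j < n) homog_proj j%:Z x = x.
Proof.
have twist (j l : nat) : (w ^ (- j%:Z)) ^+ l = (w ^ (- l%:Z)) ^+ j.
  by rewrite !exprnP !exprz_exp !mulNr mulrC.
have sum_twist (l : 'I_n) :
    \sum_(j < n) (w ^ (- j%:Z)) ^+ l = if l == 0%N :> nat then n%:R else 0.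
  under eq_bigr do rewrite twist.
  rewrite sum_expr_unity_root; last first.
    by rewrite exprnP exprz_exp mulrC prim_root_exprz.
  rewrite -exprz_inv -exprnP exprVn invr_eq1 -(prim_order_dvd prim_w).
  by case: eqVneq => [->|l0]; rewrite ?dvdn0 // gtnNdvd // lt0n.
rewrite -scaler_sumr exchange_big /=.
under eq_bigr do rewrite -scaler_suml sum_twist.
rewrite (bigD1 (Ordinal (prim_order_gt0 prim_w))) //= big1 ?addr0.
  by rewrite scalerA mulVf ?scale1r // (prim_root_natf_neq0 prim_w).
by move=> l; rewrite -val_eqE /= => /negPf ->; rewrite scale0r.
Qed.

End Homogeneous.

Section HomogeneousBracket.
Variables (K : fieldType) (g : lmodType K) (br : {bilinear g -> g -> g}).
Variables (s : {linear g -> g}) (n : nat) (w : K).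
Hypothesis s_br : forall x y, s (br x y) = br (s x) (s y).
Hypothesis (prim_w : n.-primitive_root w).
Local Notation homog := (homogeneous s w).

Lemma homogeneous_br i j x y : homog i x -> homog j y -> homog (i + j) (br x y).
Proof.
move=> hx hy; rewrite /homogeneous s_br hx hy linearZl_LR linearZr_LR scalerA.
by rewrite expfzDr ?(prim_root_neq0 prim_w).
Qed.

Hypothesis s_order : forall x, iter n s x = x.

Lemma homog_proj_br m i x y :
  homog i x -> homog_proj s n w m (br x y) = br x (homog_proj s n w (m - i) y).
Proof.
have iter_br l u v : iter l s (br u v) = br (iter l s u) (iter l s v).
  by elim: l => //= l ->; rewrite s_br.
move=> hx; rewrite /homog_proj linearZr_LR linear_sumr; congr (_ *: _).
apply: eq_bigr => l _.
rewrite iter_br (iter_homogeneous _ hx) linearZl_LR linearZr_LR.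
by rewrite scalerA -exprMn -expfzDr ?(prim_root_neq0 prim_w) // opprB addrC.
Qed.

Hypothesis perfect_g : perfect_lie br.

Lemma perfect_homogeneous_eq0 (U : zmodType) m (f : g -> U) :
  (forall x y, homog m x -> homog m y -> f (x + y) = f x + f y) ->
  (forall i x y, homog i x -> homog (m - i) y -> f (br x y) = 0) ->
  forall x, homog m x -> f x = 0.
Proof.
move=> fD f_br x hx; pose Q u := homog m u /\ f u = 0.
have f0 : f 0 = 0.
  have h0 := homogeneous0 s w m.
  by apply: (addrI (f 0)); rewrite -fD // !addr0.
have Q0 : Q 0 by split=> //; exact: homogeneous0.
have QD u v : Q u -> Q v -> Q (u + v).
  move=> [hu fu] [hv fv]; split; first exact: homogeneousD.
  by rewrite fD // fu fv addr0.
suff [] : Q (homog_proj s n w m x) by rewrite (homog_proj_id prim_w).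
have [r [_ ->]] := perfect_g x; rewrite linear_sum; apply: big_ind => // p _.
rewrite -(sum_homog_proj s prim_w p.1) linear_sumlz linear_sum /=.
apply: big_ind => // j _.
have hj := homogeneous_homog_proj prim_w s_order j p.1.
split; first exact: homogeneous_homog_proj.
rewrite (homog_proj_br _ _ hj).
by apply: (f_br j%:Z) => //; exact: homogeneous_homog_proj.
Qed.

Lemma perfect_homogeneous_br_br_eq0 (U : zmodType) m (f : g -> U) :
  (forall x y, homog m x -> homog m y -> f (x + y) = f x + f y) ->
  (forall i j x y z, homog i x -> homog j y -> homog (m - (i + j)) z ->
     f (br (br x y) z) = 0) ->
  forall x, homog m x -> f x = 0.
Proof.
move=> fD f_br_br; apply: perfect_homogeneous_eq0 => // k x z hx hz.
apply: (perfect_homogeneous_eq0 (f := fun u => f (br u z)) _ _ hx) =>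
  [u v hu hv|i u v hu hv].
  have homog_m t : homog k t -> homog m (br t z).
    by move=> ht; rewrite -(subrKC k m); exact: homogeneous_br.
  by rewrite linearDl fD //; exact: homog_m.
by apply: (f_br_br i (k - i)) => //; rewrite subrKC.
Qed.

End HomogeneousBracket.

Section CommutativeCocycle.
Variables (K : fieldType) (V : lmodType K) (S : set V) (br : V -> V -> V).
Variable phi : V -> V -> K.
Hypothesis S0 : S 0.
Hypothesis S_linear : forall a x y, S x -> S y -> S (a *: x + y).
Hypothesis phi_cocycle : comm_cocycle_on S br phi.

Lemma subspaceD x y : S x -> S y -> S (x + y).
Proof. by move=> Sx Sy; rewrite -[x]scale1r; exact: S_linear. Qed.

Lemma subspace_sum I (r : seq I) (P : pred I) (F : I -> V) :
  (forall i, P i -> S (F i)) -> S (\sum_(i <- r | P i) F i).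
Proof. by move=> SF; apply: big_ind => //; exact: subspaceD. Qed.

Lemma cocycleC x y : S x -> S y -> phi x y = phi y x.
Proof. by case: phi_cocycle => symm _ _; exact: symm. Qed.

Lemma cocyclePl a x y z : S x -> S y -> S z ->
  phi (a *: x + y) z = a * phi x z + phi y z.
Proof. by case: phi_cocycle => _ lin _; exact: lin. Qed.

Lemma cocycleDl x y z : S x -> S y -> S z -> phi (x + y) z = phi x z + phi y z.
Proof. by move=> Sx Sy Sz; rewrite -{1}[x]scale1r cocyclePl ?mul1r. Qed.

Lemma cocycle0l z : S z -> phi 0 z = 0.
Proof.
by move=> Sz; apply: (addrI (phi 0 z)); rewrite -cocycleDl // !addr0.
Qed.

Lemma cocycleZl a x z : S x -> S z -> phi (a *: x) z = a * phi x z.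
Proof.
by move=> Sx Sz; rewrite -[a *: x]addr0 cocyclePl // cocycle0l // addr0.
Qed.

Lemma cocycle_suml_eq0 I (r : seq I) (P : pred I) (F : I -> V) z : S z ->
  (forall i, P i -> S (F i)) -> (forall i, P i -> phi (F i) z = 0) ->
  phi (\sum_(i <- r | P i) F i) z = 0.
Proof.
move=> Sz SF F0; pose Q x := S x /\ phi x z = 0.
suff [] : Q (\sum_(i <- r | P i) F i) by [].
apply: big_ind => [|x y [Sx x0] [Sy y0]|i Pi].
- by split; last exact: cocycle0l.
- by split; [exact: subspaceD | rewrite cocycleDl // x0 y0 addr0].
- by split; [exact: SF | exact: F0].
Qed.

Lemma cocycle_br x y z : S x -> S y -> S z ->
  phi (br x y) z + phi (br z x) y + phi (br y z) x = 0.
Proof. by case: phi_cocycle => _ _; apply. Qed.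

Lemma cocycle_central x y z : S x -> S y -> S z ->
  br z x = 0 -> br y z = 0 -> phi (br x y) z = 0.
Proof.
move=> Sx Sy Sz zx yz; have := cocycle_br Sx Sy Sz.
by rewrite zx yz !cocycle0l ?addr0.
Qed.

Lemma trivial_cocycle_of_br :
  (forall x y, S x -> S y -> S (br x y)) ->
  (forall x y z, S x -> S y -> S z -> phi (br x y) z = 0) ->
  trivial_cocycle_on S br phi.
Proof.
move=> S_br phi_br0 x y [r [Sr ->]] Sy.
have Sbr p : p \in r -> S (br p.1 p.2) by move=> /Sr[]; exact: S_br.
have Ssum : S (\sum_(p <- r) br p.1 p.2).
  by rewrite big_seq; exact: subspace_sum.
suff sum0 : phi (\sum_(p <- r) br p.1 p.2) y = 0.
  by split; last rewrite cocycleC.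
rewrite big_seq; apply: cocycle_suml_eq0 => // p pr.
by have [Sp1 Sp2] := Sr p pr; exact: phi_br0.
Qed.

Variables (d : V) (Sd : S d).

Definition weight_vector (a : K) (x : V) : Prop :=
  [/\ S x, br d x = a *: x & br x d = - (a *: x)].

Lemma cocycle_weight a b x y : weight_vector a x -> weight_vector b y ->
  phi (br x y) d = (b - a) * phi x y.
Proof.
move=> [Sx dx _] [Sy _ yd]; have := cocycle_br Sx Sy Sd.
rewrite dx yd -scaleNr !cocycleZl // (cocycleC Sy Sx) => sum0.
by apply: (eq_of_subr_eq sum0); ring.
Qed.

Lemma cocycle_weight_div a b x y : weight_vector a x -> weight_vector b y ->
  b - a != 0 -> phi x y = phi (br x y) d / (b - a).
Proof. by move=> wx wy ab; rewrite (cocycle_weight wx wy) mulrC mulKf. Qed.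

Lemma cocycle_weight3 a b c x y z :
  weight_vector a x -> weight_vector b y -> weight_vector c z ->
  weight_vector (a + b) (br x y) -> weight_vector (c + a) (br z x) ->
  weight_vector (b + c) (br y z) ->
  c - (a + b) != 0 -> b - (c + a) != 0 -> a - (b + c) != 0 ->
  phi (br (br x y) z) d / (c - (a + b)) + phi (br (br z x) y) d / (b - (c + a))
    + phi (br (br y z) x) d / (a - (b + c)) = 0.
Proof.
move=> wx wy wz wxy wzx wyz c0 b0 a0; rewrite -!cocycle_weight_div //.
by apply: cocycle_br; [case: wx | case: wy | case: wz].
Qed.

End CommutativeCocycle.

Section AffineBracket.
Variables (K : fieldType) (g : vectType K) (br : {bilinear g -> g -> g}).

Definition loop_mono (i : int) (x : g) : int -> g :=
  fun k => if k == i then x else 0.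
Definition aff_loop (f : int -> g) : aff_space K g := (f, 0, 0).
Definition aff_mono (i : int) (x : g) : aff_space K g :=
  aff_loop (loop_mono i x).
Definition aff_c : aff_space K g := (0, 1, 0).
Definition aff_d : aff_space K g := (0, 0, 1).

Lemma aff_loop_linear : linear aff_loop.
Proof. by move=> a f h; congr (_, _, _); rewrite /= scaler0 addr0. Qed.

HB.instance Definition _ :=
  GRing.isLinear.Build K (int -> g) (aff_space K g) _ aff_loop aff_loop_linear.

Lemma aff_loopZ a f : aff_loop (a *: f) = a *: aff_loop f.
Proof. exact: linearZ. Qed.

Lemma aff_loop_sum I (r : seq I) (P : pred I) (F : I -> int -> g) :
  aff_loop (\sum_(i <- r | P i) F i) = \sum_(i <- r | P i) aff_loop (F i).
Proof. exact: linear_sum. Qed.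

Lemma loop_mono_linear i : linear (loop_mono i).
Proof.
move=> a x y; apply/funext => k.
rewrite -[RHS]/(a *: loop_mono i x k + loop_mono i y k) /loop_mono.
by case: ifP => // _; rewrite scaler0 addr0.
Qed.

HB.instance Definition _ i :=
  GRing.isLinear.Build K g (int -> g) _ (loop_mono i) (loop_mono_linear i).

Lemma aff_mono_linear i : linear (aff_mono i).
Proof. by move=> a x y; rewrite /aff_mono !linearP. Qed.

HB.instance Definition _ i :=
  GRing.isLinear.Build K g (aff_space K g) _ (aff_mono i) (aff_mono_linear i).

Lemma aff_monoD i x y : aff_mono i (x + y) = aff_mono i x + aff_mono i y.
Proof. exact: linearD. Qed.

Lemma aff_mono0 i : aff_mono i 0 = 0.
Proof. exact: linear0. Qed.

Lemma aff_decomp (p : aff_space K g) :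
  p = p.1.2 *: aff_c + (p.2 *: aff_d + aff_loop p.1.1).
Proof.
case: p => [[f a] b]; congr (_, _, _); rewrite /= ?scaler0 ?add0r ?addr0 //.
- by rewrite -[_ *: _]/(a * 1) mulr1.
- by rewrite -[_ *: _]/(b * 1) mulr1.
Qed.

Lemma loop_decomp (f : int -> g)
    (fin_f : finite_set [set i | f i != 0]%classic) :
  f = \sum_(i <- fset_set [set i | f i != 0]%classic) loop_mono i (f i).
Proof.
apply/funext => k; rewrite fct_sumE /loop_mono -big_mkcond /=.
case: (boolP (k \in fset_set [set i | f i != 0]%classic)) => [kf|].
  under eq_bigl do rewrite eq_sym.
  by rewrite (fbig_pred1_inj (k := id)).
rewrite in_fset_set // notin_setE /= => /negP; rewrite negbK => /eqP fk0.
by rewrite big1 // => i /eqP <-.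
Qed.

Lemma loop_br0l h : loop_br br 0 h = 0.
Proof. by apply/funext => k; apply: fsbig1 => i _; rewrite linear0l. Qed.

Lemma loop_br0r f : loop_br br f 0 = 0.
Proof. by apply/funext => k; apply: fsbig1 => i _; rewrite linear0r. Qed.

Lemma loop_cocycle0l h : loop_cocycle br 0 h = 0.
Proof. by apply: fsbig1 => i _; rewrite killing0l mulr0. Qed.

Lemma loop_cocycle0r f : loop_cocycle br f 0 = 0.
Proof. by apply: fsbig1 => i _; rewrite killing0r mulr0. Qed.

Lemma tder0 : tder (0 : int -> g) = 0.
Proof. by apply/funext => k; rewrite /tder scaler0. Qed.

Lemma loop_br_mono i j x y :
  loop_br br (loop_mono i x) (loop_mono j y) = loop_mono (i + j) (br x y).
Proof.
apply/funext => k; rewrite /loop_br (@fsbigTE _ _ _ _ [fset i]%fset).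
  rewrite big_seq_fset1 /loop_mono eqxx subr_eq addrC.
  by case: ifP; rewrite ?linear0r.
by move=> l; rewrite inE /loop_mono => /negPf ->; rewrite linear0l.
Qed.

Lemma loop_cocycle_mono i j x y :
  loop_cocycle br (loop_mono i x) (loop_mono j y) =
  if i + j == 0 then i%:~R * killing br x y else 0.
Proof.
rewrite /loop_cocycle (@fsbigTE _ _ _ _ [fset i]%fset).
  rewrite big_seq_fset1 /loop_mono eqxx eq_sym -addr_eq0 addrC.
  by case: ifP; rewrite ?killing0r ?mulr0.
by move=> l; rewrite inE /loop_mono => /negPf ->; rewrite killing0l mulr0.
Qed.

Lemma tder_mono i x : tder (loop_mono i x) = i%:~R *: loop_mono i x.
Proof.
apply/funext => k; rewrite -[RHS]/(i%:~R *: loop_mono i x k) /tder /loop_mono.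
by case: eqP => [->//|_]; rewrite !scaler0.
Qed.

Lemma aff_br_mono i j x y :
  aff_br br (aff_mono i x) (aff_mono j y) =
  loop_cocycle br (loop_mono i x) (loop_mono j y) *: aff_c
  + aff_mono (i + j) (br x y).
Proof.
rewrite [LHS]aff_decomp /= scale0r add0r !scale0r addr0 subr0.
by rewrite loop_br_mono.
Qed.

Lemma aff_br_addcl a p q : aff_br br (a *: aff_c + p) q = aff_br br p q.
Proof. by rewrite /aff_br /= !scaler0 !add0r. Qed.

Lemma aff_br_cl p : aff_br br aff_c p = 0.
Proof.
rewrite /aff_br /= loop_br0l loop_cocycle0l tder0 scale0r scaler0.
by rewrite subr0 addr0.
Qed.

Lemma aff_br_cr p : aff_br br p aff_c = 0.
Proof.
rewrite /aff_br /= loop_br0r loop_cocycle0r tder0 scale0r scaler0.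
by rewrite subr0 addr0.
Qed.

Lemma aff_br_dl p : aff_br br aff_d p = aff_loop (tder p.1.1).
Proof.
rewrite /aff_br /= loop_br0l loop_cocycle0l tder0 scale1r scaler0.
by rewrite subr0 add0r.
Qed.

Lemma aff_br_dr p : aff_br br p aff_d = - aff_loop (tder p.1.1).
Proof.
rewrite /aff_br /= loop_br0r loop_cocycle0r tder0 scale1r scaler0 addr0 sub0r.
by rewrite -linearN.
Qed.

End AffineBracket.

Arguments aff_c {K g}.
Arguments aff_d {K g}.

Section AffineAlgebra.
Variables (K : fieldType) (g : vectType K) (br : {bilinear g -> g -> g}).
Variables (s : {linear g -> g}) (n : nat) (w : K).
Hypothesis s_br : forall x y, s (br x y) = br (s x) (s y).
Hypothesis (prim_w : n.-primitive_root w).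
Local Notation homog := (homogeneous s w).
Local Notation S := (affine_km s w).

Lemma affine_km0 : S 0.
Proof.
split=> [|i]; last exact: homogeneous0.
by apply: (@sub_finite_set _ _ set0%classic) => // i /=; rewrite eqxx.
Qed.

Lemma affine_km_linear a x y : S x -> S y -> S (a *: x + y).
Proof.
move=> [fx hx] [fy hy]; split=> [|i]; last first.
  exact: (homogeneousP a (hx i) (hy i)).
apply: (@sub_finite_set _ _
  ([set i | x.1.1 i != 0] `|` [set i | y.1.1 i != 0])%classic).
  move=> i /=; case: (eqVneq (x.1.1 i) 0) => [x0|]; last by left.
  case: (eqVneq (y.1.1 i) 0) => [y0|]; last by right.
  by rewrite -[(_ + _) i]/(a *: x.1.1 i + y.1.1 i) x0 y0 scaler0 addr0 eqxx.
by rewrite finite_setU.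
Qed.

Lemma affine_km_mono i x : homog i x -> S (aff_mono i x).
Proof.
move=> hx; split=> [|k] /=.
  apply: (@sub_finite_set _ _ [set i]%classic) => // k /=.
  by rewrite /loop_mono; case: (eqVneq k i) => //; rewrite eqxx.
by rewrite /loop_mono; case: eqP => [->|_] //; exact: homogeneous0.
Qed.

Lemma affine_km_c : S aff_c. Proof. exact: affine_km0. Qed.
Lemma affine_km_d : S aff_d. Proof. exact: affine_km0. Qed.

Lemma affine_km_tder f : S (aff_loop f) -> S (aff_loop (tder f)).
Proof.
move=> [/= ff hf]; split=> [|k] /=; last exact: homogeneousZ.
apply: sub_finite_set ff => i /=; apply: contra_neq => fi0.
by rewrite /tder fi0 scaler0.
Qed.

Lemma affine_km_loop_br f h :
  S (aff_loop f) -> S (aff_loop h) -> S (aff_loop (loop_br br f h)).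
Proof.
move=> [/= ff hf] [/= fh hh]; split=> [|k] /=.
  apply: sub_finite_set (finite_image2 (fun i j : int => i + j) ff fh).
  move=> k /= k_neq0.
  have [i _ br_neq0] := @fsbigN1 _ _ _ int int _
    (fun k i => br (f i) (h (k - i))) k k_neq0.
  exists i; first by apply: contra_neq br_neq0 => ->; rewrite linear0l.
  exists (k - i); last by rewrite addrC subrK.
  by apply: contra_neq br_neq0 => ->; rewrite linear0r.
have homog_br i : homog k (br (f i) (h (k - i))).
  by have := homogeneous_br s_br prim_w (hf i) (hh (k - i)); rewrite subrKC.
apply: (big_ind (homog k)) => // *; [exact: homogeneous0 | exact: homogeneousD].
Qed.

Lemma affine_km_br p q : S p -> S q -> S (aff_br br p q).
Proof.
move=> Sp Sq.
suff : S (aff_loop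
    (- q.2 *: tder p.1.1 + (p.2 *: tder q.1.1 + loop_br br p.1.1 q.1.1))).
  by rewrite scaleNr addrC [X in aff_loop (X + _)]addrC.
apply: (@affine_km_linear (- q.2) (aff_loop _) (aff_loop _)).
  exact: affine_km_tder.
apply: (@affine_km_linear p.2 (aff_loop _) (aff_loop _)).
  exact: affine_km_tder.
exact: affine_km_loop_br.
Qed.

Lemma weight_vector_mono i a x : homog i x -> i%:~R * a = 0 ->
  weight_vector S (aff_br br) aff_d i%:~R (a *: aff_c + aff_mono i x).
Proof.
move=> hx ia0.
have loop_part : (a *: aff_c + aff_mono i x).1.1 = loop_mono i x.
  by rewrite /= scaler0 add0r.
have degree : aff_loop (tder (a *: aff_c + aff_mono i x).1.1) =
    i%:~R *: (a *: aff_c + aff_mono i x).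
  rewrite loop_part tder_mono aff_loopZ /= scalerDr scalerA ia0.
  by rewrite scale0r add0r.
split.
- by apply: affine_km_linear; [exact: affine_km_c | exact: affine_km_mono].
- by rewrite aff_br_dl degree.
- by rewrite aff_br_dr degree.
Qed.

End AffineAlgebra.

Section AffineCocycle.
Variables (K : fieldType) (g : vectType K) (br : {bilinear g -> g -> g}).
Variables (s : {linear g -> g}) (n : nat) (w : K).
Hypothesis charK0 : [pchar K] =i pred0.
Hypothesis br_skew : forall x y, br x y = - br y x.
Hypothesis br_jacobi :
  forall x y z, br x (br y z) + br y (br z x) + br z (br x y) = 0.
Hypothesis perfect_g : perfect_lie br.
Hypothesis s_br : forall x y, s (br x y) = br (s x) (s y).
Hypothesis s_order : forall x, iter n s x = x.
Hypothesis prim_w : n.-primitive_root w.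
Local Notation homog := (homogeneous s w).
Local Notation S := (affine_km s w).

Variable phi : aff_space K g -> aff_space K g -> K.
Hypothesis phi_cocycle : comm_cocycle_on S (aff_br br) phi.

Let intrK_eq0 (z : int) : (z%:~R == 0 :> K) = (z == 0).
Proof. exact: intr_eq0_pchar0. Qed.

Let natr_neq0 k : (0 < k)%N -> k%:R != 0 :> K.
Proof. by rewrite ((pcharf0P K).1 charK0) lt0n. Qed.

Let n_gt0 : (0 < n)%N. Proof. exact: prim_order_gt0 prim_w. Qed.
Let n_neq0 : n%:R != 0 :> K. Proof. exact: natr_neq0. Qed.
Let two_neq0 : (2 : K) != 0. Proof. exact: natr_neq0. Qed.
Let three_neq0 : (3 : K) != 0. Proof. exact: natr_neq0. Qed.

Let S0 : S 0. Proof. exact: affine_km0. Qed.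
Let S_linear (a : K) (x y : aff_space K g) : S x -> S y -> S (a *: x + y).
Proof. exact: affine_km_linear. Qed.
Let Sc : S aff_c. Proof. exact: affine_km_c. Qed.
Let Sd : S aff_d. Proof. exact: affine_km_d. Qed.

Let homog_br i j x y : homog i x -> homog j y -> homog (i + j) (br x y).
Proof. exact: (homogeneous_br s_br prim_w). Qed.

Lemma cocycle_mono_eq0_of_br m z : S z ->
  (forall i x y, homog i x -> homog (m - i) y ->
     phi (aff_mono m (br x y)) z = 0) ->
  forall x, homog m x -> phi (aff_mono m x) z = 0.
Proof.
move=> Sz; apply: (perfect_homogeneous_eq0 (f := fun x => phi (aff_mono m x) z)
  s_br prim_w s_order perfect_g) => x y hx hy.
by rewrite aff_monoD (cocycleDl phi_cocycle) //; exact: affine_km_mono.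
Qed.

Lemma cocycle_aff_br_mono i j x y z : homog i x -> homog j y -> S z ->
  phi (aff_br br (aff_mono i x) (aff_mono j y)) z =
  loop_cocycle br (loop_mono i x) (loop_mono j y) * phi aff_c z
  + phi (aff_mono (i + j) (br x y)) z.
Proof.
move=> hx hy Sz; rewrite aff_br_mono (cocyclePl phi_cocycle) //.
by apply: affine_km_mono; exact: homog_br.
Qed.

Lemma cocycle_mono_br_c i j x y : homog i x -> homog j y ->
  loop_cocycle br (loop_mono i x) (loop_mono j y) * phi aff_c aff_c
  + phi (aff_mono (i + j) (br x y)) aff_c = 0.
Proof.
move=> hx hy; rewrite -cocycle_aff_br_mono //.
by apply: (cocycle_central S0 phi_cocycle);
  rewrite ?aff_br_cl ?aff_br_cr //; exact: affine_km_mono.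
Qed.

Lemma killing_cocycle_cc_eq0 i x y : homog i x -> homog (- i) y ->
  killing br x y * phi aff_c aff_c = 0.
Proof.
move=> hx hy; have unshifted := cocycle_mono_br_c hx hy.
have := cocycle_mono_br_c
  (homogeneous_shift prim_w 1 hx) (homogeneous_shift prim_w (-1) hy).
rewrite loop_cocycle_mono.
have -> : i + n%:Z * 1 + (- i + n%:Z * -1) = i - i by ring.
move=> shifted; rewrite loop_cocycle_mono in unshifted.
rewrite subrr eqxx in shifted unshifted.
apply: (mulfI n_neq0); rewrite mulr0.
by apply: (eq_of_subr_eq (etrans shifted (esym unshifted))); ring.
Qed.

Lemma cocycle_mono_c_eq0 m x : homog m x -> phi (aff_mono m x) aff_c = 0.
Proof.
apply: cocycle_mono_eq0_of_br => // i u v hu hv.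
have := cocycle_mono_br_c hu hv; rewrite loop_cocycle_mono subrKC.
case: eqP => [m0|_]; last by rewrite mul0r add0r.
by rewrite -mulrA (@killing_cocycle_cc_eq0 i) ?mulr0 ?add0r // -[- i]add0r -m0.
Qed.

Local Notation psi m x := (phi (aff_mono m x) aff_d).

(* [(i + j) * central_term m x y z] is what the central component of
   [[[X, Y], Z]], present in total degree [m = 0] only, adds to
   [phi ([[X, Y], Z], d)]. *)
Definition central_term (m : int) (x y z : g) : K :=
  if m == 0 then killing br (br x y) z * phi aff_c aff_d else 0.

Lemma central_term_rot m x y z : central_term m x y z = central_term m z x y.
Proof.
rewrite /central_term; case: eqP => // _.
by rewrite [in RHS]killing_invariant // killingC.
Qed.

Lemma cocycle_aff_br_br_d_div i j k x y z :
  homog i x -> homog j y -> homog k z -> (k - (i + j))%:~R != 0 :> K ->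
  phi (aff_br br (aff_br br (aff_mono i x) (aff_mono j y)) (aff_mono k z)) aff_d
    / (k - (i + j))%:~R =
  psi (i + j + k) (br (br x y) z) / (k - (i + j))%:~R
    - central_term (i + j + k) x y z / 2.
Proof.
move=> hx hy hz k_neq0; have hxy := homog_br hx hy.
rewrite (aff_br_mono _ i j) aff_br_addcl cocycle_aff_br_mono //.
rewrite loop_cocycle_mono /central_term.
case: eqP => [m0|_]; last by rewrite !mul0r add0r subr0.
have k_opp : k = - (i + j) by lia.
have den : (k - (i + j))%:~R = - 2 * (i + j)%:~R :> K by rewrite k_opp; ring.
have ij_neq0 : (i + j)%:~R != 0 :> K.
  by apply: contra_neq k_neq0 => ij0; rewrite den ij0 mulr0.
by rewrite den; field; rewrite oppr_eq0 two_neq0 -intrD ij_neq0.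
Qed.

Lemma weight_vector_aff_mono i x : homog i x ->
  weight_vector S (aff_br br) aff_d i%:~R (aff_mono i x).
Proof.
move=> hx; have := weight_vector_mono br hx (mulr0 i%:~R).
by rewrite scale0r add0r.
Qed.

Lemma weight_vector_aff_br i j x y : homog i x -> homog j y ->
  weight_vector S (aff_br br) aff_d (i%:~R + j%:~R)
    (aff_br br (aff_mono i x) (aff_mono j y)).
Proof.
move=> hx hy; rewrite aff_br_mono -intrD; apply: weight_vector_mono.
  exact: homog_br.
by rewrite loop_cocycle_mono; case: eqP => [->|_]; rewrite ?mul0r ?mulr0.
Qed.

Lemma cocycle_mono_br_br_d_weighted_sum i j k x y z :
  homog i x -> homog j y -> homog k z ->
  (k - (i + j))%:~R != 0 :> K -> (j - (k + i))%:~R != 0 :> K ->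
  (i - (j + k))%:~R != 0 :> K ->
  psi (i + j + k) (br (br x y) z) / (k - (i + j))%:~R
  + psi (i + j + k) (br (br z x) y) / (j - (k + i))%:~R
  + psi (i + j + k) (br (br y z) x) / (i - (j + k))%:~R
  - 3 / 2 * central_term (i + j + k) x y z = 0.
Proof.
move=> hx hy hz k_neq0 j_neq0 i_neq0.
have := cocycle_weight3 S0 phi_cocycle Sd
  (weight_vector_aff_mono hx) (weight_vector_aff_mono hy)
  (weight_vector_aff_mono hz) (weight_vector_aff_br hx hy)
  (weight_vector_aff_br hz hx) (weight_vector_aff_br hy hz).
rewrite -!intrD -!intrB => /(_ k_neq0 j_neq0 i_neq0).
have kij : k + i + j = i + j + k by ring.
have jki : j + k + i = i + j + k by ring.
rewrite !cocycle_aff_br_br_d_div // kij jki.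
rewrite -(central_term_rot _ z x y) -(central_term_rot _ x y z).
by move=> sum0; apply: (eq_of_subr_eq sum0); ring.
Qed.

Lemma cocycle_mono_br_br_d_sum i j k x y z :
  homog i x -> homog j y -> homog k z -> let m := i + j + k in
  psi m (br (br x y) z) + psi m (br (br z x) y) + psi m (br (br y z) x) = 0.
Proof.
move=> hx hy hz m.
have S_br_br i1 i2 i3 u v t : homog i1 u -> homog i2 v -> homog i3 t ->
    i1 + i2 + i3 = m -> S (aff_mono m (br (br u v) t)).
  move=> hu hv ht <-; apply: affine_km_mono.
  by apply: homog_br => //; exact: homog_br.
have Sxyz := S_br_br _ _ _ _ _ _ hx hy hz (erefl m).
have Szxy : S (aff_mono m (br (br z x) y)).
  by apply: (S_br_br _ _ _ _ _ _ hz hx hy); rewrite /m; ring.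
have Syzx : S (aff_mono m (br (br y z) x)).
  by apply: (S_br_br _ _ _ _ _ _ hy hz hx); rewrite /m; ring.
rewrite -!(cocycleDl phi_cocycle) //; last exact: (subspaceD S_linear).
by rewrite -!aff_monoD br_br_cyclic // aff_mono0 (cocycle0l S0 phi_cocycle).
Qed.

(* Shifting [i], [j] and [k] by multiples of [n] of sum 0 changes the
   denominators in [cocycle_mono_br_br_d_weighted_sum], but neither the
   numerators nor the central term. *)
Lemma cocycle_mono_br_br_d_eq0 i j k x y z :
  homog i x -> homog j y -> homog k z ->
  psi (i + j + k) (br (br x y) z) = 0 /\ central_term (i + j + k) x y z = 0.
Proof.
move=> hx hy hz; set m := i + j + k.
have [a b e abe0 i' j' k' k_neq0 j_neq0 i_neq0|-> C0] :=
  weighted_reciprocal_sum_eq0 (i := i) (j := j) (k := k)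
    (c := - (3 / 2 * central_term m x y z)) charK0 n_gt0
    (cocycle_mono_br_br_d_sum hx hy hz).
  have mE : m = i' + j' + k'.
    by rewrite -[m]addr0 -(mulr0 n%:Z) -abe0 /m /i' /j' /k'; ring.
  rewrite -/m mE; apply: cocycle_mono_br_br_d_weighted_sum => //;
    exact: homogeneous_shift.
split=> //; apply/eqP; move/eqP: C0.
by rewrite oppr_eq0 !mulf_eq0 invr_eq0 (negPf two_neq0) (negPf three_neq0).
Qed.

Lemma cocycle_mono_d_eq0 m x : homog m x -> psi m x = 0.
Proof.
apply: (perfect_homogeneous_br_br_eq0 (f := fun u => psi m u)
  s_br prim_w s_order perfect_g) => [u v hu hv|i j u v t hu hv ht].
  by rewrite aff_monoD (cocycleDl phi_cocycle) //; exact: affine_km_mono.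
by have [] := cocycle_mono_br_br_d_eq0 hu hv ht; rewrite subrKC.
Qed.

Lemma killing_cocycle_cd_eq0 i x y : homog i x -> homog (- i) y ->
  killing br x y * phi aff_c aff_d = 0.
Proof.
move=> hx hy; apply: (perfect_homogeneous_eq0
  (f := fun u => killing br u y * phi aff_c aff_d)
  s_br prim_w s_order perfect_g _ _ hx) => [u v _ _|j u v hu hv].
  by rewrite killingDl mulrDl.
have [_] := cocycle_mono_br_br_d_eq0 hu hv hy.
by rewrite /central_term subrKC subrr eqxx.
Qed.

Lemma cocycle_mono_distinct_eq0 i j x y : homog i x -> homog j y -> i != j ->
  phi (aff_mono i x) (aff_mono j y) = 0.
Proof.
move=> hx hy ij.
have := cocycle_weight S0 phi_cocycle Sd
  (weight_vector_aff_mono hx) (weight_vector_aff_mono hy).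
rewrite cocycle_aff_br_mono // cocycle_mono_d_eq0; last exact: homog_br.
have -> : loop_cocycle br (loop_mono i x) (loop_mono j y) * phi aff_c aff_d = 0.
  rewrite loop_cocycle_mono; case: eqP => [ij0|_]; last by rewrite mul0r.
  have j_opp : - i = j by lia.
  by rewrite -mulrA (killing_cocycle_cd_eq0 hx) ?mulr0 ?j_opp.
rewrite addr0 -intrB => /esym/eqP; rewrite mulf_eq0 intrK_eq0 subr_eq0 eq_sym.
by rewrite (negPf ij) => /eqP.
Qed.

Lemma cocycle_mono_mono_eq0 i j x y : homog i x -> homog j y ->
  phi (aff_mono i x) (aff_mono j y) = 0.
Proof.
move=> hx hy; have [ij|] := eqVneq i j; last exact: cocycle_mono_distinct_eq0.
rewrite -{}ij in hy *; have Sy := affine_km_mono hy.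
apply: (cocycle_mono_eq0_of_br Sy _ hx) => a u v hu hv.
pose T : int := `|a| + `|i| + 1.
have hu' := homogeneous_shift prim_w T hu.
have hv' := homogeneous_shift prim_w (- T) hv.
have T_le : T <= n%:Z * T by rewrite ler_peMl // /T; lia.
have Su := affine_km_mono hu'; have Sv := affine_km_mono hv'.
have := cocycle_br phi_cocycle Su Sv Sy.
rewrite !cocycle_aff_br_mono // !(cocycleC phi_cocycle Sc) //.
rewrite !cocycle_mono_c_eq0 // !mulr0 !add0r.
have -> : a + n%:Z * T + (i - a + n%:Z * - T) = i by ring.
rewrite (cocycle_mono_distinct_eq0 _ hv'); [|exact: homog_br|rewrite /T; lia].
rewrite (cocycle_mono_distinct_eq0 _ hu'); [|exact: homog_br|rewrite /T; lia].
by rewrite !addr0.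
Qed.

Lemma cocycle_mono_eq0 i x z : homog i x -> S z -> phi (aff_mono i x) z = 0.
Proof.
move=> hx Sz; have Sx := affine_km_mono hx; have Szl : S (aff_loop z.1.1) := Sz.
rewrite (cocycleC phi_cocycle) // (aff_decomp z).
rewrite !(cocyclePl phi_cocycle) //; last exact: S_linear.
rewrite !(cocycleC phi_cocycle _ Sx) // cocycle_mono_c_eq0 //.
rewrite cocycle_mono_d_eq0 // !mulr0 !add0r.
rewrite (cocycleC phi_cocycle Sx) // (loop_decomp Sz.1) aff_loop_sum.
apply: (cocycle_suml_eq0 S0 S_linear phi_cocycle) => // k _.
  exact: affine_km_mono (Sz.2 k).
exact: cocycle_mono_mono_eq0 (Sz.2 k) hx.
Qed.

Lemma cocycle_loop_eq0 p z : S p -> S z -> phi (aff_loop p.1.1) z = 0.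
Proof.
move=> Sp Sz; rewrite (loop_decomp Sp.1) aff_loop_sum.
apply: (cocycle_suml_eq0 S0 S_linear phi_cocycle) => // k _.
  exact: affine_km_mono (Sp.2 k).
exact: cocycle_mono_eq0 (Sp.2 k) Sz.
Qed.

Lemma loop_cocycle_c_eq0 p q z : S p -> S q -> S z ->
  loop_cocycle br p.1.1 q.1.1 * phi aff_c z = 0.
Proof.
move=> Sp Sq Sz; have Szl : S (aff_loop z.1.1) := Sz.
rewrite (cocycleC phi_cocycle) // (aff_decomp z).
rewrite !(cocyclePl phi_cocycle) //; last exact: S_linear.
rewrite cocycle_loop_eq0 // addr0 [phi aff_d _](cocycleC phi_cocycle) //.
rewrite mulr_fsuml; apply: fsbig1 => i _.
have cc := killing_cocycle_cc_eq0 (Sp.2 i) (Sq.2 (- i)).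
have cd := killing_cocycle_cd_eq0 (Sp.2 i) (Sq.2 (- i)).
set kpq := killing _ _ _ in cc cd *.
transitivity (i%:~R * z.1.2 * (kpq * phi aff_c aff_c)
  + i%:~R * z.2 * (kpq * phi aff_c aff_d)); first by ring.
by rewrite cc cd !mulr0 addr0.
Qed.

Lemma affine_cocycle_trivial : trivial_cocycle_on S (aff_br br) phi.
Proof.
have S_br p q : S p -> S q -> S (aff_br br p q).
  exact: (affine_km_br s_br prim_w).
apply: (trivial_cocycle_of_br S0 S_linear phi_cocycle) => // p q z Sp Sq Sz.
have Sl : S (aff_loop (aff_br br p q).1.1) := S_br p q Sp Sq.
rewrite (aff_decomp (aff_br br p q)) scale0r add0r (cocyclePl phi_cocycle) //.
by rewrite loop_cocycle_c_eq0 // add0r cocycle_loop_eq0 //; exact: S_br.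
Qed.

End AffineCocycle.

Theorem theorem5p5 (K : closedFieldType) (charK0 : [pchar K] =i pred0)
    (g : vectType K) (br : g -> g -> g)
    (lie_g : lie_algebra_on setT br) (simple_g : simple_lie br)
    (n : nat) (s : g -> g)
    (diag_s : diagram_automorphism br s) (ord_s : has_order s n)
    (w : K) (prim_w : n.-primitive_root w)
    (phi : aff_space K g -> aff_space K g -> K) :
  comm_cocycle_on (affine_km s w) (aff_br br) phi ->
  trivial_cocycle_on (affine_km s w) (aff_br br) phi.
Proof.
have [[s_linear _ s_br] _] := diag_s; have [_ s_order _] := ord_s.
have two_neq0 : (2 : K) != 0 by rewrite ((pcharf0P K).1 charK0).
have three_neq0 : (3 : K) != 0 by rewrite ((pcharf0P K).1 charK0).
have br_skew := simple_lie_skew two_neq0 three_neq0 lie_g simple_g.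
pose br_bilinear := bilinear_isBilinear.Build K g g g _ _ br
  (simple_lie_bilinear two_neq0 three_neq0 lie_g simple_g).
pose brB : {bilinear g -> g -> g} := HB.pack br br_bilinear.
pose sL : {linear g -> g} :=
  HB.pack s (GRing.isLinear.Build K g g _ s s_linear).
exact: (@affine_cocycle_trivial K g brB sL n w charK0 br_skew (lie_jacobi lie_g)
  (simple_lie_perfect lie_g simple_g) s_br s_order prim_w).
Qed.
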